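(* Let $G$ be a finite group and $H$ a subgroup of $G$. Then $H$ is a perfect code of $G$ if and only if for any $g\in G\setminus H$ either the left coset $gH$ contains an involution or the integer $|H\{g,g^{-1}\}H|/|H|$ is even. In particular, if $H$ is not a perfect code of $G$, then there exists a $2$-element $x\in G\setminus H$ such that $x^{2}\in H$, $|H:H\cap xHx^{-1}|$ is odd, and $xH$ contains no involution.
   Context: For a finite group $G$ with identity $1$ and a subset $S\subseteq G\setminus\{1\}$ with $S^{-1}=S$ (possibly $S=\emptyset$), the Cayley graph $\mathrm{Cay}(G,S)$ has vertex set $G$, with $x,y$ adjacent if and only if $yx^{-1}\in S$. A perfect code in a graph $\Gamma$ with vertex set $V$ is a subset $C\subseteq V$ such that no two vertices of $C$ are adjacent and every vertex in $V\setminus C$ is adjacent to exactly one vertex in $C$. A subset (in particular a subgroup) $C$ of $G$ is called a perfect code of $G$ if there exists such an $S$ for which $C$ is a perfect code in $\mathrm{Cay}(G,S)$. An involution is an element of order exactly $2$. A $2$-element is an element whose order is a power of $2$ (the identity is included). $H\{g,g^{-1}\}H=HgH\cup Hg^{-1}H$ denotes the product set, $|X|$ the cardinality of a set $X$, and $|A:B|$ the index of a subgroup $B$ in a group $A$. *)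

(* Defs.v *)
From mathcomp Require Import all_boot all_fingroup all_solvable.

Set Implicit Arguments.
Unset Strict Implicit.
Unset Printing Implicit Defensive.

Local Open Scope group_scope.

(* A graph is given by its vertex set [V] and its adjacency relation [e], of
   which only the restriction to [V] matters. *)
Definition perfect_code (T : finType) (V : {set T}) (e : rel T)
    (C : {set T}) : Prop :=
  [/\ C \subset V,
      forall x y, x \in C -> y \in C -> x != y -> ~~ e x y
    & forall v, v \in V :\: C -> #|[set c in C | e v c]| = 1%N].

(* [S^-1] is the pointwise inverse of the set [S]. *)
Definition connection_set (gT : finGroupType) (G S : {set gT}) : Prop :=
  S \subset G :\ 1 /\ S^-1 = S.

Definition cayley_adj (gT : finGroupType) (S : {set gT}) : rel gT :=
  fun x y => y * x^-1 \in S.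

Definition group_perfect_code (gT : finGroupType) (G C : {set gT}) : Prop :=
  exists S : {set gT}, connection_set G S /\ perfect_code G (cayley_adj S) C.

Definition contains_involution (gT : finGroupType) (A : {set gT}) : Prop :=
  exists2 x, x \in A & #[x] = 2%N.

(* Main.v *)
Require Import Defs.
From mathcomp Require Import all_boot all_fingroup all_solvable.

(** A set [S] shows that [H] is a perfect code of [G] exactly when [S] is an
    inverse-closed system of representatives of the right cosets of [H] in [G]
    other than [H] itself ([perfect_code_transversal]).  So the question is
    when such an [S] exists.

    Necessity is a parity argument: [S] meets [H{g,g^-1}H] in an inverse-closed
    set with one element in each right coset, that is with [|H{g,g^-1}H|/|H|]
    elements.  If this number is odd, then inversion fixes one of them, which
    is an involution, and conjugating it by an element of [H] moves it into
    [gH].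

    Sufficiency: take an inverse-closed partial system [S] of maximal size, and
    suppose that it misses a right coset [Hw].  Any right coset [Hy] inside
    [Hw^-1H] satisfies [Hw :&: y^-1H <> set0], so if [Hy] is another missed
    coset, one can add to [S] an element [z] of this intersection together with
    [z^-1].  Hence [Hw] is the only coset in [Hw^-1H] that [S] can miss.  As [S]
    meets [HwH] and [Hw^-1H] equally often, it misses equally many cosets in
    both, so [HwH = Hw^-1H] and [S] meets this double coset in
    [|HwH|/|H| - 1] elements ([maximal_missed_coset]).  If [|HwH|/|H|] is even,
    that intersection has odd size and so contains an involution; if it is odd, then
    [wH] contains one by hypothesis.  Either way a conjugate of the involution
    lies in [Hw] and can be added to [S], against maximality.

    For the last claim, let [g] violate the criterion.  The oddness forces
    [HgH = Hg^-1H], which gives an [x] in [gH] with [x^2] in [H]; a suitable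
    odd power of [x] is a 2-element, and it stays in the coset [gH]. *)

Set Implicit Arguments.
Unset Strict Implicit.
Unset Printing Implicit Defensive.

Local Open Scope group_scope.

(** * Involutions in inverse-closed sets and in double cosets *)

(** Inversion pairs off the elements of [A] that differ from their inverses,
    so in an odd set some element is its own inverse. *)
Lemma odd_inv_closed_involution (gT : finGroupType) (A : {set gT}) :
  A^-1 = A -> 1 \notin A -> odd #|A| -> contains_involution A.
Proof.
elim: {A}#|A| {-2}A (leqnn #|A|) => [|n IHn] A.
  by rewrite leqn0 => /eqP->.
move=> leAn AV A1 oddA.
have [A0 | [x Ax]] := set_0Vmem A; first by rewrite A0 cards0 in oddA.
have AinvE y : (y^-1 \in A) = (y \in A) by rewrite -mem_invg AV.
have [xV | neq_xV] := eqVneq x^-1 x.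
  exists x => //; apply: nt_prime_order => //.
    by rewrite expgS expg1 -{1}xV mulVg.
  by apply: contraNneq A1 => <-.
have cardA : #|A| = #|A :\ x :\ x^-1|.+2.
  by rewrite (cardsD1 x) Ax (cardsD1 x^-1 (A :\ x)) !inE neq_xV AinvE Ax.
have [||||y] := IHn (A :\ x :\ x^-1).
- by rewrite -ltnS (leq_trans _ leAn) // cardA.
- apply/setP=> y; rewrite !inE AinvE (inj_eq invg_inj) -eq_invg_sym.
  by rewrite andbCA eq_invg_sym.
- by rewrite !inE (negPf A1) !andbF.
- by rewrite cardA /= negbK in oddA.
by rewrite !inE => /and3P[_ _ Ay] oy; exists y.
Qed.

Section DoubleCosets.

Variables (gT : finGroupType) (H : {group gT}).
Implicit Types (g w z : gT) (S A : {set gT}).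

Lemma mem_dcosetP g z :
  reflect (exists h k, [/\ h \in H, k \in H & z = h * g * k])
          (z \in H :* g * H).
Proof.
apply: (iffP mulsgP) => [[_ k /rcosetP[h Hh ->] Hk ->] | [h [k [Hh Hk ->]]]].
  by exists h, k.
by exists (h * g) k; rewrite // mem_rcoset mulgK.
Qed.

Lemma dcoset_refl g : g \in H :* g * H.
Proof. by apply/mem_dcosetP; exists 1, 1; rewrite !group1 mulg1 mul1g. Qed.

Lemma dcosetV g : (H :* g * H)^-1 = H :* g^-1 * H.
Proof. by rewrite !invMg invGid invg_set1 mulgA. Qed.

Lemma dcoset_eq g w : w \in H :* g * H -> H :* w * H = H :* g * H.
Proof.
case/mem_dcosetP=> h [k [Hh Hk ->]].
by rewrite !rcosetM (rcoset_id Hh) -mulgA (lcoset_id Hk).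
Qed.

Lemma mul_rcosets_dcoset g : H * (H :* g * H) = H :* g * H.
Proof. by rewrite !mulgA mulGid. Qed.

Lemma card_dcosetV g : #|H :* g^-1 * H| = #|H :* g * H|.
Proof. by rewrite -dcosetV card_invg. Qed.

Lemma card_dcoset g : #|H :* g * H| = (#|H : H :&: H :^ g^-1| * #|H|)%N.
Proof.
have -> : H :* g * H = g *: (H :^ g * H).
  by rewrite conjsgE -(mulgA [set g^-1]) lcosetKV.
rewrite card_lcoset; apply/eqP.
rewrite -(eqn_pmul2r (cardG_gt0 (H :^ g :&: H))) -mul_cardG cardJg.
rewrite -{1}(Lagrange (subsetIl H (H :^ g^-1))) -(cardJg (H :&: _) g).
by rewrite conjIg -conjsgM mulVg conjsg1 -mulnA mulnC.
Qed.

(** Conjugating [h * g * k] by [h] gives [g * (k * h)], and by [k^-1] gives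
    [(k * h) * g]; so the orders occurring in [HgH] already occur in [gH] and in
    [Hg]. *)
Lemma dcoset_involution_lcoset g :
  contains_involution (H :* g * H) -> contains_involution (g *: H).
Proof.
case=> _ /mem_dcosetP[h [k [Hh Hk ->]]] oz.
exists ((h * g * k) ^ h); last by rewrite orderJ.
by rewrite conjgE !mulgA mulVg mul1g mem_lcoset !mulgA mulVg mul1g groupM.
Qed.

Lemma dcoset_involution_rcoset g :
  contains_involution (H :* g * H) -> contains_involution (H :* g).
Proof.
case=> _ /mem_dcosetP[h [k [Hh Hk ->]]] oz.
exists ((h * g * k) ^ k^-1); last by rewrite orderJ.
by rewrite conjgE invgK !mulgA mulgK mem_rcoset mulgK groupM.
Qed.

Lemma dcoset_pairE g :
  H * [set g; g^-1] * H = (H :* g * H) :|: (H :* g^-1 * H).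
Proof. by rewrite mulgU mulUg. Qed.

(** Double cosets are equal or disjoint; disjoint ones [HgH] and [Hg^-1H] have
    the same size and contribute an even number of cosets. *)
Lemma odd_dcoset_pair g :
    odd (#|H * [set g; g^-1] * H| %/ #|H|) ->
  g^-1 \in H :* g * H /\ odd #|H : H :&: H :^ g^-1|.
Proof.
rewrite dcoset_pairE; have [gV | gV] := boolP (g^-1 \in H :* g * H).
  by rewrite (dcoset_eq gV) setUid card_dcoset mulnK ?cardG_gt0.
rewrite cardsU disjoint_setI0 ?cards0 ?subn0.
  by rewrite card_dcosetV addnn card_dcoset doubleMl mulnK ?odd_double.
apply/pred0P=> z /=; apply: contraNF gV => /andP[/dcoset_eq <- /dcoset_eq->].
exact: dcoset_refl.
Qed.

End DoubleCosets.

(** * Inverse-closed partial transversals *)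

Section Transversals.

Variables (gT : finGroupType) (G H : {group gT}).
Implicit Types (w z : gT) (S A : {set gT}).

(** Injectivity of [rcoset H] on [S] says that [S] has at most one element in
    each right coset; the predicate is boolean so that maximal sets exist. *)
Definition inv_partial_transversal S :=
  [&& S \subset G :\: H, S^-1 == S & dinjectiveb (rcoset H) (mem S)].

Definition inv_transversal S :=
  inv_partial_transversal S /\ H * S = G :\: H.

Lemma inv_partial_transversalP S :
  reflect [/\ S \subset G :\: H, S^-1 = S & {in S &, injective (rcoset H)}]
          (inv_partial_transversal S).
Proof.
by apply: (iffP and3P) => [[? /eqP? /dinjectiveP?] | [? /eqP? /dinjectiveP?]].
Qed.

Lemma card_mul_partial_transversal S :
  {in S &, injective (rcoset H)} -> #|H * S| = (#|S| * #|H|)%N.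
Proof.
move=> injS; rewrite [H * S]curry_imset2X card_in_imset ?cardsX 1?mulnC //.
case=> [h s] [k t] /setXP[/= Hh Ss] /setXP[/= Hk St] eq_hs.
have eq_st : s = t.
  apply: injS => //; rewrite !rcosetE.
  by rewrite -[in LHS](rcoset_id Hh) -[in RHS](rcoset_id Hk) -!rcosetM eq_hs.
by congr (_, _) => //; apply: (mulIg s); rewrite eq_hs eq_st.
Qed.

(** [S] selects one element in each of the right cosets of [H * S], so it
    selects [|A|/|H|] elements in a union [A] of such cosets. *)
Lemma card_transversal_cap S A :
    {in S &, injective (rcoset H)} -> H * A = A ->
  #|A :&: H * S| = (#|S :&: A| * #|H|)%N.
Proof.
move=> injS HA; rewrite -card_mul_partial_transversal; last first.
  by move=> x y /setIP[Sx _] /setIP[Sy _]; apply: injS.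
congr #|pred_of_set _|; apply/setP=> z.
apply/setIP/mulsgP=> [[Az /mulsgP[h s Hh Ss def_z]] | ].
  exists h s => //; rewrite inE Ss -HA; apply/mulsgP.
  by exists h^-1 z; rewrite ?groupV // def_z mulKg.
case=> h s Hh /setIP[Ss As] ->; split; first by rewrite -HA mem_mulg.
exact: mem_mulg.
Qed.

Lemma card_inv_closed_cap S A : S^-1 = S -> #|S :&: A^-1| = #|S :&: A|.
Proof. by move=> SV; rewrite -{1}SV -invIg card_invg. Qed.

Lemma inv_partial_transversal1 S : inv_partial_transversal S -> 1 \notin S.
Proof.
case/inv_partial_transversalP=> /subsetP sS _ _; apply/negP=> /sS.
by rewrite inE group1.
Qed.

Lemma perfect_code_transversal :
  H \subset G -> group_perfect_code G H <-> exists S, inv_transversal S.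
Proof.
move=> sHG; split=> [[S [[sSG SV] [_ indep dom]]] | [S [tS HS]]]; exists S.
  have sS : S \subset G :\: H.
    apply/subsetP=> s Ss; have /setD1P[nt_s Gs] := subsetP sSG s Ss.
    rewrite inE Gs andbT; apply/negP=> Hs.
    have := indep _ _ (group1 H) Hs; rewrite eq_sym => /(_ nt_s).
    by rewrite /cayley_adj invg1 mulg1 Ss.
  have memV x : x \in G :\: H -> x^-1 \in G :\: H.
    by rewrite !inE !groupV.
  split; last first.
    apply/setP=> x; apply/mulsgP/idP=> [[h s Hh Ss ->] | Dx].
      have /setDP[Gs nHs] := subsetP sS s Ss.
      by rewrite inE groupMl // nHs groupM // (subsetP sHG).
    have /eqP/cards1P[c def_c] := dom _ (memV x Dx).
    have := set11 c; rewrite -def_c inE /cayley_adj invgK => /andP[Hc Scx].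
    by exists c^-1 (c * x); rewrite ?groupV ?mulKg.
  apply/inv_partial_transversalP; split=> // x y Sx Sy eq_xy.
  (* The vertex [x^-1] is adjacent to the codewords [1] and [y * x^-1]. *)
  have /eqP/cards1P[c def_c] := dom _ (memV x (subsetP sS x Sx)).
  have : 1 \in [set c].
    by rewrite -def_c inE group1 /cayley_adj mul1g invgK.
  have : y * x^-1 \in [set c].
    rewrite -def_c inE /cayley_adj invgK mulgKV Sy andbT -mem_rcoset.
    by rewrite -(rcosetE H x) eq_xy rcosetE rcoset_refl.
  rewrite !inE => /eqP eq_yx /eqP eq_1.
  by apply/esym/eqP; rewrite eq_mulgV1 eq_yx eq_1.
have /inv_partial_transversalP[sS SV injS] := tS.
split.
  split=> //; rewrite subsetD1 (inv_partial_transversal1 tS) andbT.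
  exact: subset_trans sS (subsetDl _ _).
split=> // [x y Hx Hy _ | v Dv].
  apply/negP=> /(subsetP sS); rewrite inE.
  by rewrite groupM ?groupV.
have: v^-1 \in H * S by rewrite HS !inE !groupV -in_setD.
case/mulsgP=> h s Hh Ss def_v; apply/eqP/cards1P; exists h^-1.
apply/setP=> c; rewrite !inE /cayley_adj def_v.
apply/andP/eqP=> [[Hc Schs] | ->]; last by rewrite groupV mulKg.
have eq_s : c * (h * s) = s.
  by apply: injS => //; rewrite !rcosetE mulgA rcosetM rcoset_id // groupM.
by apply: (mulIg (h * s)); rewrite eq_s mulKg.
Qed.

(** The case [z^-1 = z] adds a single involution, and the case where [z^-1] is
    in a different right coset adds a pair. *)
Lemma inv_partial_transversalU S z :
    inv_partial_transversal S -> z \in G :\: H ->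
    z \notin H * S -> z^-1 \notin H * S -> (z^-1 \in H :* z -> z^-1 = z) ->
  inv_partial_transversal (S :|: [set z; z^-1]).
Proof.
case/inv_partial_transversalP=> sS SV injS Dz nSz nSzV zV.
apply/inv_partial_transversalP; split.
- rewrite subUset sS subUset !sub1set Dz.
  by rewrite !inE !groupV in Dz *.
- by rewrite invUg SV invUg !invg_set1 invgK [[set _] :|: _]setUC.
have new x y : x \notin H * S -> y \in S -> rcoset H x = rcoset H y -> x = y.
  move=> nSx Sy eq_xy; case/negP: nSx; have /rcosetP[h Hh ->] : x \in H :* y.
    by rewrite -(rcosetE H y) -eq_xy rcosetE rcoset_refl.
  exact: mem_mulg.
have zzV : rcoset H z = rcoset H z^-1 -> z = z^-1.
  by move=> eqz; rewrite zV // -(rcosetE H z) eqz rcosetE rcoset_refl.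
move=> x y /setUP[Sx | /set2P[] ->] /setUP[Sy | /set2P[] ->] eq_xy //;
  by [apply: injS | apply: new | apply/esym/new | apply: zzV
     | apply/esym/zzV].
Qed.

Lemma exists_maximal_transversal : exists S, maxset inv_partial_transversal S.
Proof.
have t0 : inv_partial_transversal set0.
  apply/inv_partial_transversalP; split; first exact: sub0set.
    by apply/setP=> x; rewrite !inE.
  by move=> x y; rewrite inE.
by have [S maxS _] := maxset_exists t0; exists S.
Qed.

(** The only way maximality is used: nothing that [inv_partial_transversalU]
    could add to a maximal [S] exists. *)
Lemma maximal_transversal_stuck S z :
    maxset inv_partial_transversal S -> z \in G :\: H ->
    z \notin H * S -> z^-1 \notin H * S -> (z^-1 \in H :* z -> z^-1 = z) ->
  False.
Proof.
case/maxsetP=> tS maxS Dz nSz nSzV zV; apply: (negP nSz).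
have /maxS <- := inv_partial_transversalU tS Dz nSz nSzV zV.
  apply/mulsgP; exists 1 z; rewrite ?group1 ?mul1g //.
  by rewrite !inE eqxx orbT.
exact: subsetUl.
Qed.

Hypothesis sHG : H \subset G.

Lemma missed_rcoset S w z : z \in H :* w -> (z \in H * S) = (w \in H * S).
Proof.
case/rcosetP=> h Hh ->; apply/mulsgP/mulsgP=> [[k s Hk Ss] | [k s Hk Ss ->]].
  by move/(canRL (mulKg h)) => ->; exists (h^-1 * k) s;
     rewrite ?groupM ?groupV ?mulgA.
by exists (h * k) s; rewrite ?groupM ?mulgA.
Qed.

(** A maximal [S] misses no coset [Hy] of [Hw^-1H] except possibly [Hw], since
    an element of [Hw] whose inverse is in [Hy] could be added to it. *)
Lemma maximal_missed_subset S w :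
    maxset inv_partial_transversal S -> w \in G :\: H -> w \notin H * S ->
  (H :* w^-1 * H) :\: H * S \subset H :* w.
Proof.
move=> maxS Dw nSw; apply/subsetP=> y /setDP[/mem_dcosetP[h [k [Hh Hk def_y]]]].
move=> nSy; apply/negPn/negP=> nwy.
have Hwz : k^-1 * w \in H :* w by rewrite mem_rcoset mulgK groupV.
have HyzV : (k^-1 * w)^-1 \in H :* y.
  by rewrite mem_rcoset def_y !invMg !invgK !mulgA !mulgK mulVg mul1g groupV.
apply: (maximal_transversal_stuck maxS) (_ : k^-1 * w \in _) _ _ _.
- have /setDP[Gw nHw] := Dw; rewrite inE groupMl ?groupV // nHw.
  by rewrite groupM // groupV (subsetP sHG).
- by rewrite (missed_rcoset S Hwz).
- by rewrite (missed_rcoset S HyzV).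
rewrite (rcoset_eqP Hwz) => zVw; case/negP: nwy.
by rewrite -(rcoset_eqP zVw) (rcoset_eqP HyzV) rcoset_refl.
Qed.

(** As [S] is inverse-closed, it misses equally many elements of [HwH] and of
    [Hw^-1H]; since [Hw] is missed in the former, it has to be the missed coset
    of the latter. *)
Lemma maximal_missed_coset S w :
    maxset inv_partial_transversal S -> w \in G :\: H -> w \notin H * S ->
  H :* w^-1 * H = H :* w * H /\
  #|H :* w * H| = (#|S :&: (H :* w * H)%g|.+1 * #|H|)%N.
Proof.
move=> maxS Dw nSw; have sDw := maximal_missed_subset maxS Dw nSw.
have /maxsetP[/inv_partial_transversalP[sS SV injS] _] := maxS.
have cardD g := card_transversal_cap injS (mul_rcosets_dcoset H g).
have cap_wV : #|S :&: (H :* w^-1 * H)| = #|S :&: (H :* w * H)|.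
  by rewrite -dcosetV card_inv_closed_cap.
have missV : #|(H :* w^-1 * H) :\: H * S| = #|(H :* w * H) :\: H * S|.
  by rewrite !cardsD !cardD cap_wV card_dcosetV.
have sHwD : H :* w \subset (H :* w * H) :\: H * S.
  apply/subsetP=> z Hwz; rewrite inE (missed_rcoset S Hwz) nSw.
  by rewrite -[z]mulg1 mem_mulg ?group1.
have /eqP miss : (H :* w^-1 * H) :\: H * S == H :* w.
  by rewrite eqEcard sDw missV subset_leq_card.
split.
  apply/esym/dcoset_eq.
  by have: w \in H :* w by [apply: rcoset_refl]; rewrite -{1}miss => /setDP[].
rewrite -(cardsID (H * S)) cardD -missV miss card_rcoset mulSn.
by rewrite addnC.
Qed.

(** * The criterion *)

(** Both directions produce an involution from the parity of [S :&: HgH], where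
    [S] is complete in one and misses a single coset in the other; the two
    parities differ, which is why the second alternative of the criterion
    provides an involution for an incomplete [S]. *)
Lemma transversal_criterion :
  (exists S, inv_transversal S) <->
  (forall g, g \in G :\: H ->
     contains_involution (g *: H) \/
     ~~ odd (#|H * [set g; g^-1] * H| %/ #|H|)).
Proof.
split=> [[S [tS HS]] g Dg | crit].
  have [oddD | evenD] := boolP (odd _); [left | by right].
  have /inv_partial_transversalP[sS SV injS] := tS.
  have [gV _] := odd_dcoset_pair oddD.
  have eqD := dcoset_eq gV.
  apply: dcoset_involution_lcoset.
  have sD : H :* g * H \subset H * S.
    rewrite HS; apply/subsetP=> _ /mem_dcosetP[h [k [Hh Hk ->]]].
    have /setDP[Gg nHg] := Dg.
    by rewrite inE groupMr // groupMl // nHg !groupM // (subsetP sHG).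
  have [|||z /setIP[_ Dz] oz] := @odd_inv_closed_involution _ (S :&: (H :* g * H)).
  - by rewrite invIg SV dcosetV eqD.
  - by rewrite inE (negPf (inv_partial_transversal1 tS)).
  - move: oddD; rewrite dcoset_pairE eqD setUid -{1}(setIidPl sD).
    rewrite card_transversal_cap ?mul_rcosets_dcoset //.
    by rewrite mulnK ?cardG_gt0.
  by exists z.
have [S maxS] := exists_maximal_transversal; exists S.
have /maxsetP[tS _] := maxS.
have /inv_partial_transversalP[sS SV injS] := tS.
split=> //; apply/eqP; rewrite eqEsubset; apply/andP; split.
  apply/subsetP=> _ /mulsgP[h s Hh Ss ->].
  have /setDP[Gs nHs] := subsetP sS s Ss.
  by rewrite inE groupMl // nHs groupM // (subsetP sHG).
apply/subsetP=> w Dw; apply/negPn/negP=> nSw.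
have [eqD cardD] := maximal_missed_coset maxS Dw nSw.
have invD : contains_involution (H :* w * H).
  have [[z wHz oz] | ] := crit w Dw.
    exists z => //; apply/mulsgP; have /lcosetP[h Hh ->] := wHz.
    by exists w h; rewrite ?rcoset_refl.
  rewrite dcoset_pairE eqD setUid cardD mulnK ?cardG_gt0 //= negbK => oddS.
  have [|||z /setIP[_ Dz] oz] := @odd_inv_closed_involution _ (S :&: (H :* w * H)).
  - by rewrite invIg SV dcosetV eqD.
  - by rewrite inE (negPf (inv_partial_transversal1 tS)).
  - by [].
  by exists z.
(* An involution of [Hw] is a legal addition to [S], being its own inverse. *)
have [z Hwz oz] := dcoset_involution_rcoset invD.
have zV : z^-1 = z by rewrite invg_expg oz expg1.
apply: (maximal_transversal_stuck maxS) (_ : z \in _) _ _ _.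
- have /rcosetP[h Hh ->] := Hwz; have /setDP[Gw nHw] := Dw.
  by rewrite inE groupMl // nHw groupM // (subsetP sHG).
- by rewrite (missed_rcoset S Hwz).
- by rewrite zV (missed_rcoset S Hwz).
by [].
Qed.

End Transversals.

(** From [g^-1 = h * g * k] one gets [(g * h)^2 = k^-1 * h], an element of [H].
    As the square is in [H], odd powers of [g * h] remain in [gH]; raising
    to the odd part of its order gives a 2-element. *)
Lemma two_elt_in_lcoset (gT : finGroupType) (H : {group gT}) g :
    g^-1 \in H :* g * H ->
  exists x, [/\ x \in g *: H, 2.-elt x & x ^+ 2 \in H].
Proof.
case/mem_dcosetP=> h [k [Hh Hk def_gV]]; pose y := g * h.
have Hy2 : y ^+ 2 \in H.
  have hgE : h * g = g^-1 * k^-1 by rewrite def_gV mulgK.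
  rewrite expgS expg1 /y -mulgA [h * _]mulgA hgE !mulgA mulgV mul1g.
  by rewrite groupM ?groupV.
pose m := (#[y]`_2^')%N.
have odd_m : odd m by rewrite odd_2'nat part_pnat.
exists (y ^+ m); split; last by rewrite -expgM mulnC expgM groupX.
  rewrite -(odd_double_half m) odd_m -mul2n expgS expgM.
  by rewrite mem_lcoset /y !mulgA mulVg mul1g groupM // groupX.
by rewrite p_elt_exp.
Qed.

(* The quotient [%/] is exact, and [H :^ x^-1] is x H x^-1, as [H :^ y]
   is y^-1 H y. *)
Theorem theorem3p1 (gT : finGroupType) (G H : {group gT}) (sHG : H \subset G) :
  (group_perfect_code G H <->
     forall g, g \in G :\: H ->
       contains_involution (g *: H) \/
       ~~ odd (#|H * [set g; g^-1] * H| %/ #|H|)) /\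
  (~ group_perfect_code G H ->
     exists x, [/\ x \in G :\: H, 2.-elt x, x ^+ 2 \in H,
                   odd #|H : H :&: H :^ x^-1|
                 & ~ contains_involution (x *: H)]).
Proof.
have crit := iff_trans (perfect_code_transversal sHG) (transversal_criterion sHG).
split=> // ncode.
(* Boolean forms, so that failure of the criterion yields a witness [g]. *)
pose has_inv g := [exists z in g *: H, #[z] == 2%N].
have has_invP g : reflect (contains_involution (g *: H)) (has_inv g).
  by apply: (iffP exists_inP) => -[z gHz /eqP oz]; exists z => //; apply/eqP.
pose bad g := ~~ has_inv g && odd (#|H * [set g; g^-1] * H| %/ #|H|).
have [/exists_inP[g Dg /andP[noinv oddD]] | good] :=
  boolP [exists g in G :\: H, bad g]; last first.
  case: ncode; apply/crit=> g Dg; have := exists_inPn good g Dg.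
  by rewrite negb_and negbK => /orP[/has_invP | ]; [left | right].
have [gV oddI] := odd_dcoset_pair oddD.
have [x [gHx x2 Hx2]] := two_elt_in_lcoset gV; exists x.
have eq_xg : x *: H = g *: H by apply/lcoset_eqP.
have [h Hh def_x] := lcosetP gHx.
split=> //.
- have /setDP[Gg nHg] := Dg.
  by rewrite def_x inE groupMr // nHg groupM // (subsetP sHG).
- by rewrite def_x invMg conjsgM [H :^ h^-1]conjGid ?groupV.
by rewrite eq_xg => /has_invP; apply/negP.
Qed.
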